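(* Let $-1<q<1$, let $n\ge1$, let $f_1,\dots,f_n\in H_0$, and let $\xi_j=\phi(f_j)$ ($1\le j\le n$) be the corresponding $q$-Gaussian random variables. Then $$\xi_1\cdots\xi_n=\sum_{\gamma\in\mathsf F(n)}:\!v(\gamma)\!:\,q^{tc(\gamma)}.$$
   Context: **$q$-Fock space.** $H_0$ is a real Hilbert space and $H$ its complexification; $-1<q<1$ is fixed (convention $0^0=1$). On the algebraic direct sum $\mathcal F_q^{\rm alg}(H)=\mathbb C\Omega\oplus H\oplus H^{\otimes 2}\oplus\cdots$ (algebraic tensor powers, $\Omega$ a unit vector) one defines a hermitian inner product (linear in the first variable) by $$\langle f_1\otimes\cdots\otimes f_m,\,g_1\otimes\cdots\otimes g_n\rangle=\delta_{mn}\sum_{\pi\in S_n}\langle f_1,g_{\pi(1)}\rangle\cdots\langle f_n,g_{\pi(n)}\rangle\,q^{\iota(\pi)},$$ where $\iota(\pi)=\#\{(i,j):1\le i<j\le n,\ \pi(i)>\pi(j)\}$. The $q$-Fock space $\mathcal F_q(H)$ is the completion. **Operators.** For $f\in H_0$, $a^+(f)$ and $a^-(f)$ are the bounded operators on $\mathcal F_q(H)$ (adjoints of each other) determined by $a^+(f)\Omega=f$, $a^+(f)(f_1\otimes\cdots\otimes f_n)=f\otimes f_1\otimes\cdots\otimes f_n$, and $a^-(f)\Omega=0$, $a^-(f)(f_1\otimes\cdots\otimes f_n)=\sum_{i=1}^n q^{i-1}\langle f,f_i\rangle f_1\otimes\cdots\otimes\widehat{f_i}\otimes\cdots\otimes f_n$,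 where for $f\in H_0$ the map $\langle f,\cdot\rangle$ here denotes the complex-linear extension to $H$ of the real inner product with $f$, and $\widehat{f_i}$ means that $f_i$ is omitted (the empty tensor being $\Omega$). The $q$-Gaussians are the operators $\phi(f)=a^+(f)+a^-(f)$, $f\in H_0$. For bounded operators $b$ on $\mathcal F_q(H)$ set $\mathbb E(b)=\langle b\Omega,\Omega\rangle$; in particular $\mathbb E(\phi(f)\phi(g))=\langle f,g\rangle$ for $f,g\in H_0$. **$q$-Wick product.** For $\xi_i=\phi(f_i)$, $f_i\in H_0$, $$:\!\xi_1\cdots\xi_n\!:\;=W(f_1,\dots,f_n)=\sum a^+(f_{i_1})\cdots a^+(f_{i_k})\,a^-(f_{j_1})\cdots a^-(f_{j_l})\,q^{\iota(I,J)},$$ the sum over all (possibly empty) $I=\{i_1<\dots<i_k\}$, $J=\{j_1<\dots<j_l\}$ with $I\sqcup J=\{1,\dots,n\}$, where $\iota(I,J)=\#\{(r,s):i_r>j_s\}$. The Wick product of the empty family is the identity $I$. **Feynman diagrams.** A Feynman diagram $\gamma$ on a finite linearly ordered set $S$ is a partition of $S$ into one- and two-element sets; it is identified with the set of its two-element blocks written as ordered pairs $(i,j)$ with $i<j$; elements in one-element blocks (unpaired) are called singletons. $\mathsf F(n)$ is the set of all Feynman diagrams on $[n]=\{1,\dots,n\}$ (including the one with no pairs). For $(i,j)\in\gamma$, $c_l(i,j)$ is the number of pairs $(k,l)\in\gamma$ with $k<i<l<j$, and $c(\gamma)=\sum_{(i,j)\in\gamma}c_l(i,j)$. $d(\gamma)$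 is the number of triples $i<k<j$ with $(i,j)\in\gamma$ and $k$ a singleton of $\gamma$. The total crossing number is $tc(\gamma)=c(\gamma)+d(\gamma)$. For $\gamma\in\mathsf F(n)$ with singletons $h_1<\dots<h_r$, $v(\gamma)=\big(\prod_{(i,j)\in\gamma}\mathbb E(\xi_i\xi_j)\big)\,\xi_{h_1}\cdots\xi_{h_r}$ and $$:\!v(\gamma)\!:\;=\Big(\prod_{(i,j)\in\gamma}\mathbb E(\xi_i\xi_j)\Big):\!\xi_{h_1}\cdots\xi_{h_r}\!:.$$ *)

(* Defs.v *)
From HB Require Import structures.
From mathcomp Require Import all_boot all_order all_algebra all_fingroup.
From mathcomp Require Import sesquilinear.
From mathcomp Require Import complex.
From mathcomp Require Import all_classical all_reals all_analysis.

Set Implicit Arguments.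
Unset Strict Implicit.
Unset Printing Implicit Defensive.

Import Order.TTheory GRing.Theory Num.Theory Num.Def.
Import numFieldNormedType.Exports.

Local Open Scope ring_scope.
Local Open Scope complex_scope.

(* A Hilbert space is a complete normed space together with a [{dot _ for _}]
   form inducing its norm. Such forms are linear in the first variable. *)
Definition induces_norm (K : numFieldType) (V : normedModType K)
    (theta : K -> K) (dot : {dot V for theta}) : Prop :=
  forall x : V, dot x x = `|x| ^+ 2.

(* The pair (x, y) stands for x + iy. *)
Definition complexification (R : realType) (V : lmodType R) : Type :=
  (V * V)%type.

Section Complexification.
Variables (R : realType) (V : lmodType R).
Local Notation H := (complexification V).

HB.instance Definition _ := GRing.Zmodule.copy H (V * V)%type.

Definition complexification_scale (z : R[i]) (h : H) : H :=
  (complex.Re z *: h.1 - complex.Im z *: h.2,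
   complex.Re z *: h.2 + complex.Im z *: h.1).

Lemma complexification_scaleA a b h :
  complexification_scale a (complexification_scale b h) =
  complexification_scale (a * b) h.
Proof.
case: a b h => [a1 a2] [b1 b2] [x y]; congr (_, _) => /=.
  rewrite !(scalerBr, scalerDr, scalerBl, scalerDl) !scalerA !opprD -!addrA.
  by congr (_ + _); rewrite addrA addrC.
rewrite !(scalerBr, scalerDr, scalerBl, scalerDl) !scalerA -!addrA.
by congr (_ + _); rewrite addrA addrC.
Qed.

Lemma complexification_scale1 : left_id 1 complexification_scale.
Proof.
by case=> x y; rewrite /complexification_scale /= !scale1r !scale0r subr0 addr0.
Qed.

Lemma complexification_scaleDr : right_distributive complexification_scale +%R.
Proof.
move=> [a1 a2] [x y] [u v]; congr (_, _) => /=.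
  by rewrite !scalerDr opprD addrACA.
by rewrite !scalerDr addrACA.
Qed.

Lemma complexification_scaleDl h :
  {morph complexification_scale^~ h : a b / a + b}.
Proof.
move=> [a1 a2] [b1 b2]; case: h => x y; congr (_, _) => /=.
  by rewrite !scalerDl opprD addrACA.
by rewrite !scalerDl addrACA.
Qed.

HB.instance Definition _ := GRing.Zmodule_isLmodule.Build R[i] H
  complexification_scaleA complexification_scale1
  complexification_scaleDr complexification_scaleDl.

Variable dot0 : {dot V for idfun}.

(* Sesquilinear, linear in the first variable. *)
Definition hermitian_ext (h k : H) : R[i] :=
  (dot0 h.1 k.1 + dot0 h.2 k.2) +i* (dot0 h.2 k.1 - dot0 h.1 k.2).

(* Linear in h, whereas [hermitian_ext (f, 0) h] is antilinear in h. *)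
Definition linear_ext (f : V) (h : H) : R[i] := dot0 f h.1 +i* dot0 f h.2.

Definition of_real (f : V) : H := (f, 0).

End Complexification.

Definition perm_inversions n (p : 'S_n) : nat :=
  #|[set ij : 'I_n * 'I_n | (ij.1 < ij.2)%N && (p ij.2 < p ij.1)%N]|.

Section FockSpace.
Variables (R : realType) (H0 : completeNormedModType R).
Variables (dot0 : {dot H0 for idfun}) (q : R).
Local Notation H := (complexification H0).
Local Notation C := (R[i]).

(* The word [:: f_1; ...; f_n] stands for the elementary tensor
   f_1 (x) ... (x) f_n, and [::] for the vacuum vector. *)
Definition fock_form (s t : seq H) : C :=
  if size s == size t then
    \sum_(p : 'S_(size s))
      (\prod_(i < size s) hermitian_ext dot0 s`_i t`_(p i))
      * q%:C ^+ perm_inversions p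
  else 0.

(* F is the completion of the algebraic Fock space: by the universal property
   of the algebraic tensor powers, a linear map from their direct sum to F is
   a family of multilinear maps, here given by its values [tens s] on
   elementary tensors; the map is isometric with dense range, and F, being of
   type completeNormedModType, is complete. *)
Record is_fock_space (F : completeNormedModType C) (dotF : {dot F for conjC})
    (tens : seq H -> F) : Prop := IsFockSpace {
  fock_norm : induces_norm dotF;
  fock_multilinear : forall (s t : seq H) (a : C) (h k : H),
    tens (s ++ (a *: h + k) :: t)
    = a *: tens (s ++ h :: t) + tens (s ++ k :: t);
  fock_dot : forall s t : seq H, dotF (tens s) (tens t) = fock_form s t;
  fock_dense : (closure
    [set x : F | exists l : seq (C * seq H),
       x = \sum_(u <- l) u.1 *: tens u.2] = [set: F])%classic
}.

Section Operators.
Variables (F : completeNormedModType C) (dotF : {dot F for conjC}).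
Variable tens : seq H -> F.

Definition bounded_operator (b : {linear F -> F}) : Prop :=
  exists M : C, forall x : F, `|b x| <= M * `|x|.

Definition is_creation (f : H0) (b : {linear F -> F}) : Prop :=
  bounded_operator b /\
  forall s : seq H, b (tens s) = tens (of_real f :: s).

(* The index i is 0-based, whence q ^+ i. *)
Definition is_annihilation (f : H0) (b : {linear F -> F}) : Prop :=
  bounded_operator b /\
  forall s : seq H, b (tens s) =
    \sum_(i < size s) (q%:C ^+ i * linear_ext dot0 f s`_i)
      *: tens (take i s ++ drop i.+1 s).

Definition vacuum_expectation (b : F -> F) : C := dotF (b (tens [::])) (tens [::]).

Variables (ap am : H0 -> {linear F -> F}).

Definition gaussian (f : H0) : F -> F := ap f \+ am f.

Definition comp_prod (l : seq (F -> F)) : F -> F :=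
  \big[(fun a b => a \o b)/idfun]_(a <- l) a.

Definition wick_crossings n (I : {set 'I_n}) : nat :=
  #|[set ij : 'I_n * 'I_n |
      [&& ij.1 \in I, ij.2 \notin I & (ij.2 < ij.1)%N]]|.

(* Enumerations of sets of ordinals are increasing. *)
Definition wick (s : seq H0) : F -> F :=
  \sum_(I : {set 'I_(size s)}) (q%:C ^+ wick_crossings I) *:
     (comp_prod [seq (ap s`_i : F -> F) | i : 'I_(size s) <- enum I] \o
      comp_prod [seq (am s`_j : F -> F) | j : 'I_(size s) <- enum (~: I)]).

End Operators.
End FockSpace.

Section Feynman.
Variable n : nat.
Implicit Type g : {set {set 'I_n}}.

(* [finset.partition] excludes empty blocks. *)
Definition feynman : {set {set {set 'I_n}}} :=
  [set g : {set {set 'I_n}} |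
     finset.partition g [set: 'I_n] && [forall B in g, (#|B| <= 2)%N]].

Definition pairs g : {set 'I_n * 'I_n} :=
  [set ij : 'I_n * 'I_n |
     (ij.1 < ij.2)%N && ([set ij.1; ij.2] \in g)].

Definition unpaired g : {set 'I_n} := [set k : 'I_n | [set k] \in g].

Definition left_crossings g (ij : 'I_n * 'I_n) : nat :=
  #|[set kl : 'I_n * 'I_n in pairs g |
      [&& (kl.1 < ij.1)%N, (ij.1 < kl.2)%N & (kl.2 < ij.2)%N]]|.

Definition crossings g : nat := (\sum_(ij in pairs g) left_crossings g ij)%N.

Definition degenerate_crossings g : nat :=
  #|[set ijk : ('I_n * 'I_n) * 'I_n |
      [&& ijk.1 \in pairs g, ijk.2 \in unpaired g,
          (ijk.1.1 < ijk.2)%N & (ijk.2 < ijk.1.2)%N]]|.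

Definition total_crossings g : nat := (crossings g + degenerate_crossings g)%N.

End Feynman.

Section WickFeynman.
Variables (R : realType) (H0 : completeNormedModType R) (q : R).
Variables (F : completeNormedModType R[i]) (dotF : {dot F for conjC}).
Variable tens : seq (complexification H0) -> F.
Variables (ap am : H0 -> {linear F -> F}).
Variables (n : nat) (f : 'I_n -> H0).

Definition wick_feynman (g : {set {set 'I_n}}) : F -> F :=
  (\prod_(ij in pairs g)
     vacuum_expectation dotF tens
       (gaussian ap am (f ij.1) \o gaussian ap am (f ij.2))) *:
  wick q ap am [seq f h | h <- enum (unpaired g)].

End WickFeynman.

(* Main.v *)
Require Import Defs.
From mathcomp Require Import all_boot all_order all_algebra all_fingroup.
From mathcomp Require Import sesquilinear complex.
From mathcomp Require Import all_classical all_reals all_analysis.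
(* finset again, so that its names take precedence over classical_sets. *)
From mathcomp Require Import finset ring.
Import Order.TTheory GRing.Theory Num.Theory Num.Def.
Import numFieldNormedType.Exports.
Set Implicit Arguments.
Unset Strict Implicit.
Unset Printing Implicit Defensive.
Local Open Scope ring_scope.
Local Open Scope complex_scope.

(** The relation [a^-(f) a^+(g) = <f, g> I + q a^+(g) a^-(f)] holds on
    elementary tensors, hence everywhere by density and boundedness.  It yields
    [xi_1 :xi_2 ... xi_n: = :xi_1 ... xi_n: +
       sum_k q^(k-2) E(xi_1 xi_k) :xi_2 ... (omit xi_k) ... xi_n:].
    The theorem follows by induction on [n]: a diagram on [n+1] points comes
    from a unique diagram on the last [n] ones, either by adding the first point
    as a singleton or by pairing it with one of the singletons [h].  The latter
    increases the total crossing number by the number of singletons before [h],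
    which is exactly the exponent in the recursion above. *)

(** * Diagrams on n+1 points built from diagrams on the last n points *)

Section FeynmanRecursion.
Variable n : nat.
Implicit Types (g : {set {set 'I_n}}) (h : 'I_n).

Local Notation up := (lift (@ord0 n)).

Definition shift_set (B : {set 'I_n}) : {set 'I_n.+1} := up @: B.
Definition unshift_set (B : {set 'I_n.+1}) : {set 'I_n} := up @^-1: B.

Definition cons_singleton g : {set {set 'I_n.+1}} :=
  [set ord0] |: shift_set @: g.
Definition cons_pair g h : {set {set 'I_n.+1}} :=
  [set ord0; up h] |: shift_set @: (g :\ [set h]).
(** Under [unshift_set] a block [[set ord0]] becomes empty, hence the deletion of [set0]; a pair
    containing [ord0] leaves its other point as a singleton. *)
Definition remove_first (G : {set {set 'I_n.+1}}) : {set {set 'I_n}} :=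
  (unshift_set @: G) :\ set0.

Lemma shift_setK : cancel shift_set unshift_set.
Proof.
by move=> B; apply/setP => x; rewrite inE mem_imset //; apply: lift_inj.
Qed.

Lemma unshift_setK (B : {set 'I_n.+1}) :
  ord0 \notin B -> shift_set (unshift_set B) = B.
Proof.
move=> B0; apply/setP => x; apply/imsetP/idP => [[y]|xB].
  by rewrite inE => yB ->.
case: (unliftP ord0 x) => [y xy|x0]; last by rewrite -x0 xB in B0.
by exists y; rewrite // inE -xy.
Qed.

Lemma ord0_shift_set (B : {set 'I_n}) : (ord0 \in shift_set B) = false.
Proof. by apply/negbTE/imsetP => -[]. Qed.

Lemma lift_shift_set (B : {set 'I_n}) x : (up x \in shift_set B) = (x \in B).
Proof. by rewrite mem_imset //; apply: lift_inj. Qed.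

Lemma unshift_set1 : unshift_set [set ord0] = set0.
Proof. by apply/setP => x; rewrite !inE. Qed.

Lemma unshift_set2 h : unshift_set [set ord0; up h] = [set h].
Proof. by apply/setP => x; rewrite !inE /= (inj_eq lift_inj). Qed.

Lemma imset_shift_setK g : unshift_set @: (shift_set @: g) = g.
Proof.
rewrite -imset_comp -[RHS]imset_id; apply: eq_imset => B /=.
exact: shift_setK.
Qed.

Lemma feynmanE g : (g \in feynman n) =
  finset.partition g [set: 'I_n] && [forall B in g, (#|B| <= 2)%N].
Proof. by rewrite inE. Qed.

Lemma remove_cons_singleton g :
  g \in feynman n -> remove_first (cons_singleton g) = g.
Proof.
rewrite feynmanE => /andP[/and3P[_ _ g0] _].
by rewrite /remove_first imsetU1 imset_shift_setK unshift_set1 setU1K.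
Qed.

Lemma remove_cons_pair g h :
  g \in feynman n -> [set h] \in g -> remove_first (cons_pair g h) = g.
Proof.
rewrite feynmanE => /andP[/and3P[_ _ g0] _] hg.
rewrite /remove_first imsetU1 imset_shift_setK unshift_set2 setD1K //.
by apply/setDidPl; rewrite disjoint_sym disjoints1.
Qed.

Lemma setT_ordS : [set: 'I_n.+1] = ord0 |: shift_set [set: 'I_n].
Proof.
apply/setP => x; rewrite !inE; case: (unliftP ord0 x) => [y ->|->].
  by rewrite lift_shift_set inE orbT.
by rewrite eqxx.
Qed.

Lemma cons_singleton_feynman g :
  g \in feynman n -> cons_singleton g \in feynman n.+1.
Proof.
rewrite !inE => /andP[gP /forall_inP g2]; apply/andP; split.
  rewrite setT_ordS; apply: partitionU1.
  - by rewrite imset_partition //; apply: lift_inj.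
  - by apply/set0Pn; exists ord0; rewrite inE.
  - by rewrite disjoints1 ord0_shift_set.
apply/forall_inP => B; rewrite !inE => /orP[/eqP->|/imsetP[D Dg ->]].
  by rewrite cards1.
by rewrite card_imset ?g2 //; apply: lift_inj.
Qed.

Lemma cons_pair_feynman g h :
  g \in feynman n -> [set h] \in g -> cons_pair g h \in feynman n.+1.
Proof.
rewrite !inE => /andP[gP /forall_inP g2] hg; apply/andP; split.
  have -> : [set: 'I_n.+1] = [set ord0; up h] :|: shift_set ([set: 'I_n] :\ h).
    apply/setP => x; rewrite !inE; case: (unliftP ord0 x) => [y ->|-> //].
    rewrite lift_shift_set !inE (inj_eq lift_inj) andbT.
    by case: (y == h); rewrite ?orbT.
  apply: partitionU1.
  - rewrite imset_partition; last exact: lift_inj.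
    exact: partitionD1.
  - by apply/set0Pn; exists ord0; rewrite !inE.
  - rewrite disjoints_subset subUset !sub1set !inE.
    by rewrite ord0_shift_set lift_shift_set !inE eqxx.
apply/forall_inP => B; rewrite !inE => /orP[/eqP->|/imsetP[D]].
  by rewrite cards2.
by rewrite inE => /andP[_ Dg] ->; rewrite card_imset ?g2 //; apply: lift_inj.
Qed.

Lemma card2_ord0 (B : {set 'I_n.+1}) : ord0 \in B -> (#|B| <= 2)%N ->
  B = [set ord0] \/ exists h, B = [set ord0; up h].
Proof.
move=> B0; rewrite (cardsD1 ord0) B0 ltnS => B1.
rewrite -(setD1K B0); move: B1; rewrite leq_eqVlt ltnS leqn0 => /orP[].
  case/cards1P => x xE; right; rewrite xE.
  have : x \in B :\ ord0 by rewrite xE inE.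
  case: (unliftP ord0 x) => [h -> _|->]; last by rewrite !inE eqxx.
  by exists h.
by move/eqP/cards0_eq => ->; left; rewrite setU0.
Qed.

(** The block of [ord0] has at most two elements, so the first point is alone or has one partner
    [h]; in the second case [h] is put back as a singleton to obtain [g]. *)
Lemma feynmanS_cases (G : {set {set 'I_n.+1}}) : G \in feynman n.+1 ->
  exists2 g, g \in feynman n &
    G = cons_singleton g \/ exists2 h, [set h] \in g & G = cons_pair g h.
Proof.
rewrite inE => /andP[GP /forall_inP G2].
have [/eqP Gcov Gtriv G0] := and3P GP.
have : ord0 \in cover G by rewrite Gcov inE.
case/bigcupP => B BG B0.
(* Disjointness keeps [ord0] out of every block other than [B], so these blocks survive the round
   trip. *)
have shiftK : shift_set @: (unshift_set @: (G :\ B)) = G :\ B.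
  rewrite -imset_comp -[RHS]imset_id; apply: eq_in_imset => D.
  rewrite !inE => /andP[DB DG].
  rewrite /= unshift_setK //; apply: contra DB => D0.
  by rewrite -(def_pblock Gtriv BG B0) (def_pblock Gtriv DG D0).
have PD := partitionD1 GP BG.
have shiftP (D : {set 'I_n}) : [set: 'I_n.+1] :\: B = shift_set D ->
    finset.partition (unshift_set @: (G :\ B)) D.
  by move=> DE; rewrite DE -shiftK imset_partition in PD; last exact: lift_inj.
have small D : D \in unshift_set @: (G :\ B) -> (#|D| <= 2)%N.
  case/imsetP => D'; rewrite inE => /andP[_ D'G] ->.
  apply: leq_trans (G2 _ D'G); rewrite -(card_imset _ (@lift_inj _ ord0)).
  by apply/subset_leq_card/fintype.subsetP => y /imsetP[z]; rewrite inE => ? ->.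
case: (card2_ord0 B0 (G2 _ BG)) => [BE|[h BE]].
  exists (unshift_set @: (G :\ B)); last first.
    by left; rewrite /cons_singleton shiftK -BE setD1K.
  rewrite inE shiftP /=; first exact/forall_inP.
  apply/setP => x; rewrite BE !inE; case: (unliftP ord0 x) => [y ->|->].
    by rewrite lift_shift_set inE.
  by rewrite ord0_shift_set.
have hP : finset.partition (unshift_set @: (G :\ B)) ([set: 'I_n] :\ h).
  apply: shiftP; apply/setP => x; rewrite BE !inE.
  case: (unliftP ord0 x) => [y ->|->].
    by rewrite lift_shift_set !inE (inj_eq lift_inj).
  by rewrite ord0_shift_set.
exists ([set h] |: unshift_set @: (G :\ B)).
  rewrite inE; apply/andP; split.
    rewrite -(setD1K (in_setT h)); apply: partitionU1 => //.
      by apply/set0Pn; exists h; rewrite inE.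
    by rewrite disjoints1 !inE eqxx.
  apply/forall_inP => D; rewrite 2!inE => /orP[/eqP->|/small//].
  by rewrite cards1.
right; exists h; rewrite ?setU11 // /cons_pair setU1K ?shiftK -?BE ?setD1K //.
(* The carried-over blocks cover exactly the points other than [h], so [[set h]] is not yet among
   them. *)
apply/negP => hU; have /and3P[/eqP hcov _ _] := hP.
have : h \in cover (unshift_set @: (G :\ B)).
  by apply/bigcupP; exists [set h]; rewrite ?inE.
by rewrite hcov !inE eqxx.
Qed.

Lemma feynman_fiber g : g \in feynman n ->
  [set G in feynman n.+1 | remove_first G == g] =
  cons_singleton g |: [set cons_pair g h | h in unpaired g].
Proof.
move=> gF; apply/setP => G; rewrite inE in_setU1.
apply/andP/orP => [[/feynmanS_cases[g' g'F GE] /eqP Gg]|].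
  case: GE => [GE|[h hg GE]].
    by left; apply/eqP; rewrite -Gg GE remove_cons_singleton.
  right; apply/imsetP; exists h; first by rewrite inE -Gg GE remove_cons_pair.
  by rewrite -Gg GE remove_cons_pair.
case=> [/eqP->|/imsetP[h]].
  by rewrite cons_singleton_feynman // remove_cons_singleton.
by rewrite inE => hg ->; rewrite cons_pair_feynman // remove_cons_pair.
Qed.

Lemma cons_pair_inj g : {in unpaired g &, injective (cons_pair g)}.
Proof.
move=> h k _ _ /setP /(_ [set ord0; up h]).
rewrite setU11 => /esym; rewrite !inE => /orP[/eqP/setP/(_ (up h))|].
  by rewrite !inE /= eqxx (inj_eq lift_inj) => /esym/eqP.
case/imsetP => D _ /setP/(_ ord0).
by rewrite ord0_shift_set !inE.
Qed.

Lemma cons_singleton_notin g :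
  cons_singleton g \notin [set cons_pair g h | h in unpaired g].
Proof.
apply/negP => /imsetP[h _ /setP/(_ [set ord0])].
rewrite setU11 !inE => /esym/orP[/eqP/setP/(_ (up h))|].
  by rewrite !inE eqxx.
by case/imsetP => D _ /setP/(_ ord0); rewrite ord0_shift_set !inE.
Qed.

(** The sum is grouped by [remove_first]; its fiber over [g] consists of one diagram with the first
    point alone and a distinct one for each singleton of [g]. *)
Lemma big_feynmanS (V : nmodType) (T : {set {set 'I_n.+1}} -> V) :
  \sum_(G in feynman n.+1) T G =
  \sum_(g in feynman n)
    (T (cons_singleton g) + \sum_(h in unpaired g) T (cons_pair g h)).
Proof.
rewrite (partition_big remove_first (mem (feynman n))) /=; last first.
  move=> G /feynmanS_cases[g gF [->|[h hg ->]]].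
    by rewrite remove_cons_singleton.
  by rewrite remove_cons_pair.
apply: eq_bigr => g gF.
rewrite -(big_imset _ (@cons_pair_inj g)) -big_setU1 ?cons_singleton_notin //=.
by rewrite -feynman_fiber //; apply: eq_bigl => G; rewrite [RHS]inE.
Qed.

End FeynmanRecursion.

(** * Pairs, singletons and crossing numbers after adding the first point *)

Section Crossings.
Variable n : nat.
Implicit Types (g : {set {set 'I_n}}) (h : 'I_n).

Local Notation up := (lift (@ord0 n)).

Definition shift_pair (ij : 'I_n * 'I_n) : 'I_n.+1 * 'I_n.+1 :=
  (up ij.1, up ij.2).

Lemma shift_pair_inj : injective shift_pair.
Proof.
by move=> [i j] [k l] /pair_equal_spec[/lift_inj/= -> /lift_inj/= ->].
Qed.

Lemma shift_set_inj : injective (@shift_set n).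
Proof. exact: can_inj (@shift_setK n). Qed.

Lemma shift_set_set1 h : shift_set [set h] = [set up h].
Proof. exact: imset_set1. Qed.

Lemma shift_set_set2 h k : shift_set [set h; k] = [set up h; up k].
Proof. by rewrite /shift_set imsetU1 imset_set1. Qed.

Lemma ord0_in_shift g (B : {set 'I_n.+1}) :
  ord0 \in B -> (B \in @shift_set n @: g) = false.
Proof.
by move=> B0; apply/negbTE/imsetP => -[D _ BE]; rewrite BE ord0_shift_set in B0.
Qed.

(** Shifted blocks avoid [ord0], so the pairs among them are the shifted pairs of [g]. The block [B]
    is left general to serve both [cons_singleton] and [cons_pair]. *)
Lemma pairs_shift (B : {set 'I_n.+1}) g : ord0 \in B ->
  pairs (B |: @shift_set n @: g) =
  [set ij : 'I_n.+1 * 'I_n.+1 | (ij.1 < ij.2)%N && ([set ij.1; ij.2] == B)]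
  :|: shift_pair @: pairs g.
Proof.
move=> B0; apply/setP => -[i j]; rewrite !inE /= andb_orr; congr (_ || _).
case: (unliftP ord0 i) => [i' ->|->]; last first.
  rewrite ord0_in_shift ?inE ?eqxx // andbF.
  by apply/esym/imsetP => -[[k l] _ []].
case: (unliftP ord0 j) => [j' ->|->] //.
rewrite -[(up i', up j')]/(shift_pair (i', j')).
  rewrite mem_imset; last exact: shift_pair_inj.
  by rewrite !inE /= -shift_set_set2 mem_imset; last exact: shift_set_inj.
by apply/esym/imsetP => -[[k l] _ []].
Qed.

Lemma unpaired_shift (B : {set 'I_n.+1}) g : ord0 \in B ->
  unpaired (B |: @shift_set n @: g) =
  [set k : 'I_n.+1 | [set k] == B] :|: up @: unpaired g.
Proof.
move=> B0; apply/setP => k; rewrite !inE; congr (_ || _).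
case: (unliftP ord0 k) => [k' ->|->].
  rewrite -shift_set_set1 mem_imset; last exact: shift_set_inj.
  by rewrite (mem_imset _ _ (@lift_inj _ ord0)) inE.
rewrite ord0_in_shift ?inE //.
by apply/esym/imsetP => -[].
Qed.

Lemma set2_neq1 (T : finType) (x y z : T) :
  x != y -> ([set x; y] == [set z]) = false.
Proof.
move=> xy; apply/eqP => /(congr1 (fun A : {set T} => #|A|)).
by rewrite cards2 xy cards1.
Qed.

Lemma pairsD1 g h : pairs (g :\ [set h]) = pairs g.
Proof.
apply/setP => -[i j]; rewrite !inE /=; case: ltnP => //= ij.
by rewrite set2_neq1 // -val_eqE neq_ltn ij.
Qed.

Lemma unpairedD1 g h : unpaired (g :\ [set h]) = unpaired g :\ h.
Proof. by apply/setP => k; rewrite !inE (inj_eq set1_inj). Qed.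

Lemma pairs_cons_singleton g : pairs (cons_singleton g) = shift_pair @: pairs g.
Proof.
rewrite /cons_singleton pairs_shift ?set11 //; apply/setUidPr/fintype.subsetP.
move=> [i j]; rewrite inE /= => /andP[ij].
by rewrite set2_neq1 // -val_eqE neq_ltn ij.
Qed.

Lemma unpaired_cons_singleton g :
  unpaired (cons_singleton g) = ord0 |: up @: unpaired g.
Proof.
rewrite /cons_singleton unpaired_shift ?set11 //; congr (_ :|: _).
by apply/setP => k; rewrite !inE (inj_eq set1_inj).
Qed.

Lemma pairs_cons_pair g h :
  pairs (cons_pair g h) = (ord0, up h) |: shift_pair @: pairs g.
Proof.
rewrite /cons_pair pairs_shift ?set21 // pairsD1; congr (_ :|: _).
apply/setP => -[i j]; rewrite !inE /=.
apply/andP/eqP => [[ij /eqP E]|[-> ->]//].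
have : j \in [set ord0; up h] by rewrite -E set22.
rewrite !inE => /orP[/eqP j0|/eqP jh]; first by rewrite j0 in ij.
have : i \in [set ord0; up h] by rewrite -E set21.
rewrite !inE => /orP[/eqP i0|/eqP ih]; first by rewrite i0 jh.
by rewrite ih jh ltnn in ij.
Qed.

Lemma unpaired_cons_pair g h :
  unpaired (cons_pair g h) = up @: (unpaired g :\ h).
Proof.
rewrite /cons_pair unpaired_shift ?set21 // unpairedD1.
apply/setUidPr/fintype.subsetP.
by move=> k; rewrite inE eq_sym set2_neq1.
Qed.

Lemma left_crossingsE m (g : {set {set 'I_m}}) ij :
  left_crossings g ij = (\sum_(kl in pairs g)
    [&& kl.1 < ij.1, ij.1 < kl.2 & kl.2 < ij.2])%N.
Proof.
rewrite -big_mkcondr /left_crossings -sum1_card.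
by apply: eq_bigl => kl; rewrite inE.
Qed.

Lemma degenerate_crossingsE m (g : {set {set 'I_m}}) :
  degenerate_crossings g =
  (\sum_(ij in pairs g) \sum_(k in unpaired g) (ij.1 < k < ij.2))%N.
Proof.
rewrite pair_big /= -big_mkcondr /degenerate_crossings -sum1_card.
by apply: eq_bigl => kl; rewrite inE -!andbA.
Qed.

Lemma big_shift_pair (V : Type) (idx : V) (op : Monoid.com_law idx)
    (A : {set 'I_n * 'I_n}) (T : 'I_n.+1 * 'I_n.+1 -> V) :
  \big[op/idx]_(ij in shift_pair @: A) T ij =
  \big[op/idx]_(ij in A) T (shift_pair ij).
Proof. by rewrite big_imset //; apply: in2W; apply: shift_pair_inj. Qed.

Lemma big_lift (V : Type) (idx : V) (op : Monoid.com_law idx)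
    (A : {set 'I_n}) (T : 'I_n.+1 -> V) :
  \big[op/idx]_(k in up @: A) T k = \big[op/idx]_(k in A) T (up k).
Proof. by rewrite big_imset //; apply: in2W; apply: lift_inj. Qed.

(** A singleton in first position lies under no pair, and shifting preserves the order of the other
    points. *)
Lemma total_crossings_cons_singleton g :
  total_crossings (cons_singleton g) = total_crossings g.
Proof.
rewrite /total_crossings !degenerate_crossingsE /crossings.
rewrite pairs_cons_singleton unpaired_cons_singleton !big_shift_pair.
congr (_ + _)%N; apply: eq_bigr => ij _.
  rewrite !left_crossingsE pairs_cons_singleton big_shift_pair.
  by apply: eq_bigr.
rewrite big_setU1 ?big_lift //.
by apply/imsetP => -[].
Qed.

(* Pairing the first point with h turns the degenerate crossings of h with the
   pairs of g into left crossings of those pairs; what is added are the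
   singletons preceding h. *)
Lemma total_crossings_cons_pair g h : h \in unpaired g ->
  total_crossings (cons_pair g h) =
  (total_crossings g + \sum_(k in unpaired g) (k < h))%N.
Proof.
move=> hg; rewrite /total_crossings !degenerate_crossingsE /crossings.
rewrite pairs_cons_pair unpaired_cons_pair.
have notin : (ord0, up h) \notin shift_pair @: pairs g.
  by apply/imsetP => -[? _ []].
rewrite !(big_setU1 _ notin) /= !big_shift_pair.
(* No pair starts before [ord0], so the new pair has no left crossings. *)
rewrite left_crossingsE big1 // add0n.
rewrite [X in (_ + (X + _))%N]big_lift.
rewrite [X in _ = (_ + X)%N](big_setD1 _ hg) /= ltnn add0n addnCA [in RHS]addnC.
congr (_ + _)%N; rewrite -!big_split /=; apply: eq_bigr => ij _.
rewrite !left_crossingsE pairs_cons_pair big_setU1 //= big_shift_pair.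
by rewrite big_lift (big_setD1 _ hg) /= addnAC addnA addnC addnA.
Qed.

End Crossings.

(** * Ranks in increasing enumerations *)

Lemma count_ltn_index (s : seq nat) x :
  sorted ltn s -> x \in s -> count (fun k => k < x)%N s = index x s.
Proof.
elim: s => //= y s IHs ys; rewrite inE => /predU1P[->|xs].
  rewrite eqxx ltnn add0n; apply/eqP; rewrite -leqn0 leqNgt -has_count.
  apply/hasPn => k ks; rewrite -leqNgt ltnW //.
  exact: (allP (order_path_min ltn_trans ys)).
have yx : (y < x)%N := allP (order_path_min ltn_trans ys) _ xs.
by rewrite yx (ltn_eqF yx) IHs // (path_sorted ys).
Qed.

Lemma enum_filter (T : finType) (A : {set T}) :
  enum A = [seq x <- enum T | x \in A].
Proof. by rewrite enumT. Qed.

Lemma sorted_enum_ord n (A : {set 'I_n}) : sorted ltn (map val (enum A)).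
Proof.
rewrite enum_filter sorted_map; apply: sorted_filter.
  by move=> i j k; apply: ltn_trans.
by rewrite -sorted_map val_enum_ord iota_ltn_sorted.
Qed.

(** Turns the number of singletons before [h], which a new pair adds to the crossing number, into
    the position of [h] in the list, which is the exponent in the Wick recursion. *)
Lemma index_enum_setE n (A : {set 'I_n}) (h : 'I_n) : h \in A ->
  (\sum_(k in A) (k < h))%N = index h (enum A).
Proof.
move=> hA; rewrite -(index_map val_inj) -count_ltn_index ?sorted_enum_ord //.
  by rewrite -big_enum /= -big_mkcond /= sum1_count count_map.
by rewrite mem_map ?mem_enum //; apply: val_inj.
Qed.

(** * Subsets of n+1 points and their inversions *)

Section EnumOrd.
Variable n : nat.
Local Notation up := (lift (@ord0 n)).

Lemma enum_imset_lift (A : {set 'I_n}) : enum (up @: A) = map up (enum A).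
Proof.
rewrite [LHS]enum_filter [in RHS]enum_filter enum_ordSl /=.
have -> : (ord0 \in up @: A) = false by apply/negbTE/imsetP => -[].
rewrite filter_map; congr map; apply: eq_filter => i /=.
by rewrite (mem_imset _ _ (@lift_inj _ ord0)).
Qed.

Lemma enum_setU_lift (A : {set 'I_n}) :
  enum (ord0 |: up @: A) = ord0 :: map up (enum A).
Proof.
rewrite [LHS]enum_filter [in RHS]enum_filter enum_ordSl /= setU11.
rewrite filter_map; congr (_ :: map _ _); apply: eq_filter => i /=.
by rewrite !inE (mem_imset _ _ (@lift_inj _ ord0)).
Qed.

Lemma enum_setD1 (A : {set 'I_n}) h : enum (A :\ h) = rem h (enum A).
Proof.
rewrite rem_filter ?enum_uniq // [LHS]enum_filter [in RHS]enum_filter.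
rewrite -[RHS]filter_predI.
by apply: eq_filter => k; rewrite !inE.
Qed.

Lemma setC_imset_lift (A : {set 'I_n}) : ~: (up @: A) = ord0 |: up @: (~: A).
Proof.
apply/setP => x; rewrite !inE; case: (unliftP ord0 x) => [y ->|->].
  by rewrite !(mem_imset _ _ (@lift_inj _ ord0)) inE.
by rewrite eqxx; apply/imsetP => -[].
Qed.

Lemma setC_setU_lift (A : {set 'I_n}) : ~: (ord0 |: up @: A) = up @: (~: A).
Proof. by rewrite -[A in LHS]setCK -setC_imset_lift setCK. Qed.

Lemma big_set_ordS (V : nmodType) (T : {set 'I_n.+1} -> V) :
  \sum_(A : {set 'I_n.+1}) T A =
  \sum_(A : {set 'I_n}) (T (ord0 |: up @: A) + T (up @: A)).
Proof.
pose split (A : {set 'I_n.+1}) := (ord0 \in A, up @^-1: A).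
pose join (p : bool * {set 'I_n}) :=
  if p.1 then ord0 |: up @: p.2 else up @: p.2.
rewrite (reindex join) /=; last first.
  exists split => [[b A] _|A _]; rewrite /split /join /=.
    have o0 : (ord0 \in up @: A) = false by apply/negbTE/imsetP => -[].
    case: b; rewrite ?setU11 ?o0; congr (_, _); apply/setP => x.
      by rewrite !inE (mem_imset _ _ (@lift_inj _ ord0)).
    by rewrite inE (mem_imset _ _ (@lift_inj _ ord0)).
  apply/setP => x; case: (unliftP ord0 x) => [y ->|->].
    by case: ifP => _; rewrite ?inE /= (mem_imset _ _ (@lift_inj _ ord0)) inE.
  case: ifP => _; first by rewrite setU11.
  by apply/negbTE/imsetP => -[].
rewrite -(pair_bigA _ (fun b A => T (join (b, A)))) /= big_bool /= -big_split.
by [].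
Qed.

Lemma wick_crossingsE m (A : {set 'I_m}) :
  wick_crossings A = (\sum_(i in A) \sum_(j in ~: A) (j < i))%N.
Proof.
rewrite pair_big /= -big_mkcondr /wick_crossings -sum1_card.
by apply: eq_bigl => ij; rewrite !inE -andbA.
Qed.

(** The first point falls into the complement, that is among the annihilators, and precedes every
    creator: one more inversion for each element of [A]. *)
Lemma wick_crossings_lift (A : {set 'I_n}) :
  wick_crossings (up @: A) = (wick_crossings A + #|A|)%N.
Proof.
rewrite !wick_crossingsE setC_imset_lift big_lift -sum1_card -big_split /=.
apply: eq_bigr => i _; rewrite big_setU1 ?big_lift 1?addnC //.
by apply/imsetP => -[].
Qed.

Lemma wick_crossings_setU_lift (A : {set 'I_n}) :
  wick_crossings (ord0 |: up @: A) = wick_crossings A.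
Proof.
rewrite !wick_crossingsE setC_setU_lift big_setU1; last by apply/imsetP => -[].
rewrite big_lift /= big_lift big1 // add0n.
by apply: eq_bigr => i _; rewrite big_lift.
Qed.

End EnumOrd.

(** * Left multiplication of a Wick product by a Gaussian *)

Section WickRecursion.
Variables (R : realType) (H0 : completeNormedModType R) (q : R).
Variables (F : completeNormedModType R[i]) (ap am : H0 -> {linear F -> F}).
Implicit Types (s l : seq H0) (x : F).

Lemma comp_prod_foldr (T : Type) (b : T -> F -> F) (r : seq T) x :
  comp_prod [seq b i | i <- r] x = foldr b x r.
Proof.
elim: r => [|i r IHr] /=; first by rewrite /comp_prod big_nil.
by rewrite /comp_prod big_cons /= -IHr.
Qed.

(* Recursion on the first operator: l collects the vectors already used for
   annihilation, whose operators stand between the creators and the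
   annihilators to come. *)
Fixpoint wick_aux s l x : F :=
  if s is f :: s' then
    q%:C ^+ size l *: ap f (wick_aux s' l x) + wick_aux s' (rcons l f) x
  else foldr am x l.

(** Every vector of [l] counts as an annihilator placed before all of [s], so each creator in [I]
    has [size l] additional inversions. *)
Lemma wick_auxE s l x :
  wick_aux s l x =
  \sum_(I : {set 'I_(size s)}) q%:C ^+ (wick_crossings I + #|I| * size l) *:
    foldr (fun i : 'I_(size s) => ap s`_i)
      (foldr am (foldr (fun j : 'I_(size s) => am s`_j) x (enum (~: I))) l)
      (enum I).
Proof.
elim: s l => [|f s IHs] l /=.
  have I0 (I : {set 'I_0}) : enum I = [::].
    by apply/eqP; rewrite -size_eq0 -cardE cards_eq0; apply/eqP/setP => -[].
  rewrite (big_pred1 finset.set0) /=; last first.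
    by move=> I; apply/esym/eqP/setP => -[].
  rewrite !I0 /= cards0 mul0n addn0 wick_crossingsE.
  by rewrite big_set0 expr0 scale1r.
rewrite big_set_ordS big_split /= !IHs linear_sum scaler_sumr.
congr (_ + _); apply: eq_bigr => I _.
  rewrite wick_crossings_setU_lift cardsU1 card_imset; last exact: lift_inj.
  have -> : (ord0 \notin (lift ord0 @: I)) by apply/imsetP => -[].
  rewrite mulnDl mul1n addnCA linearZ scalerA -exprD /=.
  by rewrite setC_setU_lift enum_setU_lift enum_imset_lift /= !foldr_map.
rewrite wick_crossings_lift card_imset; last exact: lift_inj.
rewrite size_rcons mulnS addnA foldr_rcons setC_imset_lift enum_setU_lift.
by rewrite enum_imset_lift /= !foldr_map.
Qed.

Lemma wickE s x : wick q ap am s x = wick_aux s [::] x.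
Proof.
rewrite wick_auxE /wick fct_sumE; apply: eq_bigr => I _ /=.
rewrite muln0 addn0 scalrfctE /=.
rewrite (comp_prod_foldr (fun i : 'I_(size s) => ap s`_i)).
by rewrite (comp_prod_foldr (fun i : 'I_(size s) => am s`_i)).
Qed.

Variable c : H0 -> H0 -> R[i].
Hypothesis commutation : forall f g x,
  am f (ap g x) = c f g *: x + q%:C *: ap g (am f x).

(** On its way to the contracted creator at position [k], [am f] gains one q for each creator before
    it; the annihilators before it, and those of [l], contribute the inversions they had with it.
    Together these give the exponent [size l + k]. A general [l] is needed because the recursion
    lengthens it. *)
Lemma annihilation_wick_aux f s l x :
  am f (wick_aux s l x) = wick_aux s (f :: l) x +
  q%:C ^+ size l *: \sum_(k < size s)
    (q%:C ^+ k * c f s`_k) *: wick_aux (take k s ++ drop k.+1 s) l x.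
Proof.
elim: s l => [|g s IHs] l /=; first by rewrite big_ord0 scaler0 addr0.
rewrite linearD linearZ /= commutation !IHs big_ord_recl /= expr0 mul1r drop0.
rewrite size_rcons linearD linearZ linear_sum /=.
rewrite linearD linear_sum !scalerDr !scaler_sumr !scalerA -exprSr.
rewrite [c f g * _]mulrC.
(* Terms 2 and 4 make up [wick_aux (g :: s) (f :: l)], term 1 is the contraction with [g], and terms
   3 and 5 are the two halves of the contractions inside [s]. *)
rewrite !addrA [LHS](ACl (2*4*1*3*5)) /= -addrA; congr (_ + _).
rewrite -big_split; apply: eq_bigr => k _ /=.
rewrite add0n /bump add1n !linearZ /= scalerDr !scalerA scalerDr !scalerA !exprS.
by congr (_ *: _ + _ *: _); ring.
Qed.

(** With [l] empty, [ap f] supplies the half of [wick_aux (f :: s) [::]] in which [f] creates;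
    [am f] supplies the other half and the contractions. *)
Lemma gaussian_wick f s x :
  gaussian ap am f (wick q ap am s x) = wick q ap am (f :: s) x +
  \sum_(k < size s)
    (q%:C ^+ k * c f s`_k) *: wick q ap am (take k s ++ drop k.+1 s) x.
Proof.
rewrite /gaussian /= !wickE annihilation_wick_aux /= !expr0 !scale1r addrA.
by congr (_ + _); apply: eq_bigr => k _; rewrite wickE.
Qed.

End WickRecursion.

Lemma sum_index_enum (T : finType) (A : {set T}) (V : nmodType) (G : nat -> V) :
  \sum_(k < size (enum A)) G k = \sum_(h in A) G (index h (enum A)).
Proof.
rewrite -cardE [RHS]big_enum_val; apply: eq_bigr => i _.
by rewrite /enum_val index_uniq ?enum_uniq // -cardE.
Qed.

(** * The q-commutation relation and covariances on the Fock space *)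

Section Fock.
Variables (R : realType) (H0 : completeNormedModType R).
Variables (dot0 : {dot H0 for idfun}) (q : R).
Variables (F : completeNormedModType R[i]) (dotF : {dot F for conjC}).
Variable tens : seq (complexification H0) -> F.
Hypothesis fockF : is_fock_space dot0 q dotF tens.
Variables (ap am : H0 -> {linear F -> F}).
Hypothesis creation_ap : forall f, is_creation tens f (ap f).
Hypothesis annihilation_am : forall f, is_annihilation dot0 q tens f (am f).

Lemma linear_ext_of_real f g : linear_ext dot0 f (of_real g) = (dot0 f g)%:C.
Proof. by rewrite /linear_ext /of_real /= linear0r. Qed.

Lemma bounded_operator_ge0 (b : {linear F -> F}) : bounded_operator b ->
  exists2 M : R[i], 0 <= M & forall x, `|b x| <= M * `|x|.
Proof.
(* The complex bound [M] need not be nonnegative, but its product with the norm of [x] dominates a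
   norm, hence is real and at most its own modulus. *)
move=> [M bM]; exists `|M| => // x; rewrite -[`|x|]normr_id -normrM.
apply: (le_trans (bM x)); apply: real_ler_norm.
by apply: ger0_real; apply: le_trans (bM x).
Qed.

Lemma bounded_operator_comp (a b : {linear F -> F}) :
  bounded_operator a -> bounded_operator b -> bounded_operator (a \o b).
Proof.
move=> /bounded_operator_ge0[Ma Ma0 aM] [Mb bM]; exists (Ma * Mb) => x /=.
by apply: (le_trans (aM _)); rewrite -mulrA ler_wpM2l.
Qed.

Lemma bounded_operator_add (a b : {linear F -> F}) :
  bounded_operator a -> bounded_operator b -> bounded_operator (a \+ b).
Proof.
move=> [Ma aM] [Mb bM]; exists (Ma + Mb) => x /=.
by rewrite mulrDl (le_trans (ler_normD _ _)) // lerD.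
Qed.

Lemma bounded_operator_scale k (b : {linear F -> F}) :
  bounded_operator b -> bounded_operator (k \*: b).
Proof.
move=> [M bM]; exists (`|k| * M) => x /=.
by rewrite normrZ -mulrA ler_wpM2l.
Qed.

Lemma bounded_operator_id : bounded_operator (idfun : F -> F).
Proof. by exists 1 => x; rewrite mul1r. Qed.

(** If b x were nonzero, density would give y in the span of the tensors with |x - y| < |b x| / (M +
    1). Since b y = 0, |b x| <= M |x - y| < |b x|, a contradiction. The divisor M + 1 is positive
    even when M = 0. *)
Lemma bounded_operator_eq0 (b : {linear F -> F}) :
  bounded_operator b -> (forall s, b (tens s) = 0) -> forall x, b x = 0.
Proof.
move=> /bounded_operator_ge0[M M0 bM] btens x.
apply/eqP; rewrite -normr_eq0; apply/negPn/negP => n0.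
have pos : 0 < `|b x| by rewrite lt_def n0 normr_ge0.
have M1 : 0 < M + 1 by rewrite ltr_wpDl.
have : closure [set x : F | exists l : seq (R[i] * seq (complexification H0)),
    x = \sum_(u <- l) u.1 *: tens u.2]%classic x by rewrite (fock_dense fockF).
move=> /(_ _ (nbhsx_ballx x _ (divr_gt0 pos M1))) [y [[l yE]]].
rewrite -ball_normE /= ltr_pdivlMr // => xy.
have by0 : b y = 0.
  by rewrite yE linear_sum big1 // => u _; rewrite linearZ btens /= scaler0.
suff : `|b x| <= `|x - y| * (M + 1) by move=> /le_lt_trans/(_ xy); rewrite ltxx.
rewrite -[b x]subr0 -by0 -linearB (le_trans (bM _)) //.
by rewrite mulrC ler_wpM2l // lerDl.
Qed.

(** In the sum for [am f] on [of_real g :: s], index 0 contracts [g]; every other index is one more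
    than its position in [s], whence the factor q. *)
Lemma annihilation_creation_tens f g s :
  am f (ap g (tens s)) =
  (dot0 f g)%:C *: tens s + q%:C *: ap g (am f (tens s)).
Proof.
rewrite (creation_ap g).2 (annihilation_am f).2 /= big_ord_recl /=.
rewrite expr0 mul1r linear_ext_of_real drop0; congr (_ + _).
rewrite (annihilation_am f).2 linear_sum scaler_sumr; apply: eq_bigr => i _ /=.
by rewrite linearZ /= (creation_ap g).2 scalerA mulrA -exprS.
Qed.

Lemma annihilation_creation f g x :
  am f (ap g x) = (dot0 f g)%:C *: x + q%:C *: ap g (am f x).
Proof.
(* The difference of the two sides, packaged as a linear map that is bounded and vanishes on
   elementary tensors. *)
pose b : {linear F -> F} := (am f \o ap g)
  \+ ((- (dot0 f g)%:C) \*: idfun \+ (- q%:C) \*: (ap g \o am f)).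
have b0 : b x = 0.
  apply: bounded_operator_eq0 => [|s].
    apply: bounded_operator_add.
      exact: bounded_operator_comp (annihilation_am f).1 (creation_ap g).1.
    apply: bounded_operator_add; first exact: bounded_operator_scale
      bounded_operator_id.
    apply: bounded_operator_scale.
    exact: bounded_operator_comp (creation_ap g).1 (annihilation_am f).1.
  by rewrite /b /= annihilation_creation_tens !scaleNr -opprD subrr.
by apply/eqP; rewrite -subr_eq0 opprD -!scaleNr -[X in _ == X]b0.
Qed.

(** Annihilators kill the vacuum, and the two-particle vector is orthogonal to it, so only the
    commutator term survives. The vacuum has norm 1: the empty permutation is the only one and has
    no inversions. *)
Lemma vacuum_expectation_gaussian f g :
  vacuum_expectation dotF tens (gaussian ap am f \o gaussian ap am g) =
  (dot0 f g)%:C.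
Proof.
have am0 h : am h (tens [::]) = 0.
  by rewrite (annihilation_am h).2 big_ord0.
rewrite /vacuum_expectation /gaussian /= am0 addr0 annihilation_creation am0.
rewrite !(creation_ap _).2.
rewrite !linear0 addr0 linearDl /= linearZl_LR /= !(fock_dot fockF).
rewrite /fock_form /= add0r (big_pred1 1%g); last first.
  by move=> p; apply/esym/eqP/permP => -[].
rewrite big_ord0 mul1r (_ : perm_inversions _ = 0%N) ?expr0 ?mulr1 //.
by apply: eq_card0 => -[[]].
Qed.

(** * Expansion of a product of Gaussians over diagrams *)

Lemma gaussian_prod n (f : 'I_n -> H0) x :
  foldr (fun j => gaussian ap am (f j)) x (enum 'I_n) =
  \sum_(g in feynman n)
    q%:C ^+ total_crossings g *: wick_feynman q dotF tens ap am f g x.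
Proof.
elim: n f => [|n IHn] f.
  have I0 (A : pred 'I_0) : enum A = [::].
    by apply/eqP; rewrite -size_eq0 -cardE; apply/eqP/eq_card0 => -[].
  have T0 : [set: 'I_0] = finset.set0 by apply/setP => -[].
  (* On no points the empty partition is the only diagram, and its Wick product is the identity. *)
  rewrite (big_pred1 finset.set0) => [|g]; last first.
    rewrite inE T0 partition_set0 andb_idr // => /eqP ->.
    by apply/forall_inP => B; rewrite inE.
  rewrite /total_crossings degenerate_crossingsE /crossings.
  have p0 : pairs (finset.set0 : {set {set 'I_0}}) = finset.set0.
    by apply/setP => -[[]].
  rewrite p0 !big_set0 expr0 scale1r /wick_feynman p0 big_set0 scale1r.
  by rewrite !I0 /= wickE.
(* The inner factors form the product for [f] composed with [lift ord0]; both sides become sums over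
   diagrams [g] on the last n points, compared term by term. *)
rewrite enum_ordSl /= foldr_map IHn big_feynmanS.
rewrite /gaussian /= !linear_sum -big_split; apply: eq_bigr => g gF /=.
rewrite !linearZ -scalerDr total_crossings_cons_singleton.
rewrite -/(gaussian ap am (f ord0) _) /wick_feynman.
set E := \prod_(ij in pairs g) _.
rewrite pairs_cons_singleton big_shift_pair -[\prod_(ij in pairs g) _]/E.
rewrite unpaired_cons_singleton enum_setU_lift /= -map_comp.
rewrite -scalerDr -[ap _ _ + am _ _]/(gaussian ap am (f ord0) _).
rewrite (gaussian_wick annihilation_creation).
rewrite !scalerDr; congr (_ + _); first by rewrite !scalerA mulrC.
rewrite size_map (sum_index_enum (unpaired g) (fun k => (q%:C ^+ k *
  (dot0 (f ord0) [seq f (lift ord0 h) | h <- enum (unpaired g)]`_k)%:C) *: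
   wick q ap am (take k [seq f (lift ord0 h) | h <- enum (unpaired g)] ++
     drop k.+1 [seq f (lift ord0 h) | h <- enum (unpaired g)]) x)).
rewrite !scaler_sumr; apply: eq_bigr => h hg.
(* Contracting the first Gaussian with the singleton [h] matches [cons_pair g h]: the position of
   [h] is the added crossing number, and [rem] becomes the omission by [take] and [drop]. *)
rewrite total_crossings_cons_pair // index_enum_setE // pairs_cons_pair.
rewrite unpaired_cons_pair enum_imset_lift enum_setD1 remE.
rewrite -map_comp map_cat map_take map_drop.
rewrite big_setU1 ?big_shift_pair -?[\prod_(ij in pairs g) _]/E /=; last first.
  by apply/imsetP => -[? _ []].
rewrite vacuum_expectation_gaussian (nth_map h) ?index_mem ?mem_enum //.
rewrite nth_index ?mem_enum //.
by rewrite !scalerA exprD mulrACA [E * _]mulrC.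
Qed.

End Fock.

Theorem corollary3p4
  (R : realType)
  (H0 : completeNormedModType R) (dot0 : {dot H0 for idfun})
  (hdot0 : induces_norm dot0)
  (q : R) (hq : -1 < q < 1)
  (F : completeNormedModType R[i]) (dotF : {dot F for conjC})
  (tens : seq (complexification H0) -> F)
  (hF : is_fock_space dot0 q dotF tens)
  (ap am : H0 -> {linear F -> F})
  (hap : forall f : H0, is_creation tens f (ap f))
  (ham : forall f : H0, is_annihilation dot0 q tens f (am f))
  (n : nat) (hn : (1 <= n)%N) (f : 'I_n -> H0) :
  comp_prod [seq gaussian ap am (f j) | j <- enum 'I_n] =
  \sum_(g in feynman n)
    q%:C ^+ total_crossings g *: wick_feynman q dotF tens ap am f g.
Proof.
apply/funext => x; rewrite fct_sumE.
rewrite (comp_prod_foldr (fun j => gaussian ap am (f j))).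
by rewrite (gaussian_prod hF hap ham).
Qed.
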